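(* Let $\{X_j\}_{j\in\mathbb Z}$ be a zero-mean, weakly stationary, purely nondeterministic process, with finite innovations $\{\varepsilon_{j,-m}\}$ and finite AR coefficients $\{a_{k,j}\}$. Let $m>0$ and $1\le u\le m$ be integers and $K=\{-m,\dots,-1\}\setminus\{-u\}$. Then $$\sigma^2(K)=\frac{\sum_{k=0}^{u}|a_{u-k,m-k}|^2}{|a_{0,m}|^2\sum_{k=1}^{u}|a_{u-k,m-k}|^2}$$ and $$X_0-\hat X_0(K)=\alpha'_{0,m}\,\overline{a_{0,m}}\,\varepsilon_{0,-m}+\alpha'_{-u,m}\sum_{k=0}^{u}\overline{a_{u-k,m-k}}\,\varepsilon_{-k,-m},$$ where $$\alpha'_{0,m}=\frac{1}{\Delta_m}\sum_{k=0}^{u}|a_{u-k,m-k}|^2,\qquad \alpha'_{-u,m}=-\frac{\overline{a_{0,m}}\,a_{u,m}}{\Delta_m},\qquad \Delta_m=|a_{0,m}|^2\sum_{k=1}^{u}|a_{u-k,m-k}|^2.$$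
   Context: All random variables are complex-valued, mean zero and in $L^2(\Omega,\mathcal F,P)$, with inner product $(U,V):=E[U\overline V]$ and norm $\lVert U\rVert:=E[|U|^2]^{1/2}$. For a finite set $K\subset\mathbb Z$, $\hat X_l(K)$ is the orthogonal projection of $X_l$ onto $\mathrm{sp}\{X_k;k\in K\}$ ($\{0\}$ if $K=\emptyset$), and $\sigma^2(K):=\lVert X_0-\hat X_0(K)\rVert^2$. ''Purely nondeterministic'' means that $X_j\notin\overline{\mathrm{sp}}\{X_k;k<j\}$ and $X_j=\sum_{k=-\infty}^{j}b_{j-k}\varepsilon_k$ in mean square, where $\varepsilon_j$ is the normalized residual of projecting $X_j$ onto $\overline{\mathrm{sp}}\{X_k;k<j\}$ and $b_k=(X_0,\varepsilon_{-k})$. Finite innovations: for $m\ge0$, $\varepsilon_{-m,-m}:=X_{-m}/\lVert X_{-m}\rVert$ and $\varepsilon_{j,-m}:=(X_j-\hat X_j(\{-m,\dots,j-1\}))/\lVert X_j-\hat X_j(\{-m,\dots,j-1\})\rVert$ for $j>-m$. Finite MA coefficients: $b_{k,j}:=(X_j,\varepsilon_{j-k,0})$, $0\le k\le j$. Finite AR coefficients $\{a_{k,j}\}_{0\le k\le j}$: defined by $\sum_{k=i}^{j}b_{j-k,j}\,a_{k-i,k}=\delta_{ij}$ for $0\le i\le j$. *)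

(* Defs.v *)
From HB Require Import structures.
From mathcomp Require Import all_boot all_order all_algebra.
From mathcomp Require Import all_classical all_reals all_analysis.
From mathcomp Require Import complex.

Set Implicit Arguments.
Unset Strict Implicit.
Unset Printing Implicit Defensive.

Import Order.TTheory GRing.Theory Num.Theory.
Import numFieldNormedType.Exports.

Local Open Scope classical_set_scope.
Local Open Scope ring_scope.
Local Open Scope complex_scope.

Section complex_L2.
Context {d : measure_display} {T : measurableType d} {R : realType}.
Variable P : probability T R.

Definition cexpectation (f : T -> R[i]) : R[i] :=
  fine ('E_P[fun t => complex.Re (f t)])%E +i*
  fine ('E_P[fun t => complex.Im (f t)])%E.

(* The elements of L^2 are handled as functions; equality in L^2 is equality
   P-almost everywhere. Square integrability of both components is that of the
   modulus, since |z|^2 = (Re z)^2 + (Im z)^2. *)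
Definition L2 : set (T -> R[i]) := [set f |
  (fun t => complex.Re (f t)) \in Lfun P 2%:E /\
  (fun t => complex.Im (f t)) \in Lfun P 2%:E].

Definition inner (U V : T -> R[i]) : R[i] :=
  cexpectation (fun t => U t * (V t)^*%R).

Definition norm2 (U : T -> R[i]) : R :=
  Num.sqrt (fine ('E_P[fun t => (ComplexField.Normc.normc (U t) ^+ 2)%R])%E).

(* A version of the orthogonal projection of U onto the subspace M of L^2; it is
   unique up to almost everywhere equality whenever it exists. *)
Definition proj (M : set (T -> R[i])) (U : T -> R[i]) : T -> R[i] :=
  xget (fun=> 0) [set V | M V /\
    forall W, M W -> inner (fun t => U t - V t) W = 0].

Definition normalize (U : T -> R[i]) : T -> R[i] :=
  fun t => U t / (norm2 U)%:C.

Variable X : int -> T -> R[i].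

(* sp{X_k; k \in K} *)
Definition sp (K : set int) : set (T -> R[i]) := [set U | L2 U /\
  exists s : seq int, exists2 c : int -> R[i],
    (forall k, k \in s -> K k) &
    {ae P, forall t, U t = \sum_(k <- s) c k * X k t}].

(* the closure of sp{X_k; k \in K} in L^2 *)
Definition clsp (K : set int) : set (T -> R[i]) := [set U | L2 U /\
  forall e : R, 0 < e ->
    exists2 V, sp K V & norm2 (fun t => U t - V t) < e].

Definition zero_mean_process : Prop :=
  forall j, L2 (X j) /\ cexpectation (X j) = 0.

Definition weakly_stationary : Prop :=
  forall j k h : int, inner (X (j + h)) (X (k + h)) = inner (X j) (X k).

Definition past (j : int) : set int := [set k | k < j].

(* the innovation \varepsilon_j *)
Definition innovation (j : int) : T -> R[i] :=
  normalize (fun t => X j t - proj (clsp (past j)) (X j) t).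

Definition MA_coef (k : nat) : R[i] := inner (X 0) (innovation (- k%:Z)).

(* The sum over k <= j of b_{j-k} \varepsilon_k is reindexed by n = j - k. *)
Definition purely_nondeterministic : Prop :=
  forall j : int, ~ clsp (past j) (X j) /\
    (fun N : nat => norm2 (fun t =>
       X j t - \sum_(n < N) MA_coef n * innovation (j - n%:Z) t)) @ \oo
      --> (0 : R).

(* \hat X_l(K) *)
Definition predictor (l : int) (K : set int) : T -> R[i] :=
  proj (sp K) (X l).

(* \sigma^2(K) *)
Definition pred_error (K : set int) : R :=
  norm2 (fun t => X 0 t - predictor 0 K t) ^+ 2.

(* [finite_innovation m j] is \varepsilon_{j,-m}, meaningful for j >= -m. *)
Definition finite_innovation (m : nat) (j : int) : T -> R[i] :=
  if j == - m%:Z then normalize (X j)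
  else normalize (fun t =>
    X j t - predictor j [set k | - m%:Z <= k < j] t).

(* b_{k,j} *)
Definition finite_MA_coef (k j : nat) : R[i] :=
  inner (X j%:Z) (finite_innovation 0 (j%:Z - k%:Z)).

(* The triangular system defining a_{k,j} for 0 <= k <= j; the values of a
   outside this range are unconstrained. *)
Definition finite_AR_coefs (a : nat -> nat -> R[i]) : Prop :=
  forall i j : nat, (i <= j)%N ->
    \sum_(i <= k < j.+1) finite_MA_coef (j - k) j * a (k - i)%N k
    = (i == j)%:R.

End complex_L2.

(* Main.v *)
(** Put X_{-m}, ..., X_0 in triangular form X_{j-m} = sum_{k <= j} B_jk e_k, where
    e_k is the finite innovation with index k - m.  The factor B is the Cholesky
    factor with positive diagonal of the Gram matrix of X_{-m}, ..., X_0; by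
    stationarity that matrix does not depend on the window, hence neither does
    B, and b_{j-k,j} = B_jk.  The coefficients A_ki = a_{k-i,k} therefore form
    the inverse of B, and the vectors Y_i = sum_k conj(A_ki) e_k are the basis
    dual to (X_{i-m}).  The residual X_0 - X^_0(K) is orthogonal to every X_k
    with k in K, so it is a combination of Y_m and Y_{m-u}; requiring its
    expansion in the X_k to have coefficient 1 on X_0 and 0 on X_{-u} gives a
    2 x 2 system with determinant Delta_m whose solution is
    (alpha'_0, alpha'_{-u}).  By duality the squared norm of the residual is its
    coefficient on Y_m. *)
Require Import Defs.
From HB Require Import structures.
From mathcomp Require Import all_boot all_order all_algebra.
From mathcomp Require Import all_classical all_reals all_analysis.
From mathcomp Require Import complex zify ring.

Import Order.TTheory GRing.Theory Num.Theory.

Local Open Scope classical_set_scope.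
Local Open Scope ring_scope.
Local Open Scope complex_scope.

Set Implicit Arguments.
Unset Strict Implicit.

(** * The complex inner product on L^2, assembled from real ones *)

Section inner_product.
Context {d : measure_display} {T : measurableType d} {R : realType}.
Variable P : probability T R.
Implicit Types (U V W : T -> R[i]) (f g h : T -> R).

(** The real pairing from which the complex one is built: a product of two L^2 functions is
    integrable, so expectations may be split over sums. *)
Let rinner f g : R := fine ('E_P[f \* g])%E.

Lemma Lfun2_lin a f g : f \in Lfun P 2%:E -> g \in Lfun P 2%:E ->
  (fun t => a * f t + g t) \in Lfun P 2%:E.
Proof.
have p1 : (1 <= 2%:E :> \bar R)%E by rewrite lee_fin ler1n.
by case: (@Lfun_submod_closed _ _ _ P _ p1) => _ lin; exact: lin.
Qed.

Lemma Lfun2_0 : (fun=> 0) \in Lfun P 2%:E.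
Proof. exact: (Lfun_cst P 0 2). Qed.

Let rinner_lin a f g h : f \in Lfun P 2%:E -> g \in Lfun P 2%:E ->
  h \in Lfun P 2%:E -> rinner (fun t => a * f t + g t) h = a * rinner f h + rinner g h.
Proof.
move=> f2 g2 h2; rewrite /rinner.
have fh := Lfun2_mul_Lfun1 f2 h2; have gh := Lfun2_mul_Lfun1 g2 h2.
have afh : (a \o* (f \* h)) \in Lfun P 1 by exact: Lfun_scale.
rewrite (_ : (fun t => _) \* h = (a \o* (f \* h)) \+ (g \* h)); last first.
  by apply/funext => t /=; ring.
by rewrite expectationD // expectationZl // fineD ?fineM ?fin_numM ?expectation_fin_num.
Qed.

Let rinnerC f g : rinner f g = rinner g f.
Proof. by rewrite /rinner; congr (fine (expectation _ _)); apply/funext => t /=; rewrite mulrC. Qed.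

Let re U := fun t => complex.Re (U t).
Let im U := fun t => complex.Im (U t).

Let innerE U V : L2 P U -> L2 P V ->
  inner P U V = (rinner (re U) (re V) + rinner (im U) (im V)) +i*
                (rinner (im U) (re V) - rinner (re U) (im V)).
Proof.
move=> [rU iU] [rV iV]; rewrite /inner /cexpectation /rinner.
congr (_ +i* _).
  rewrite -fineD ?expectation_fin_num ?Lfun2_mul_Lfun1 // -expectationD ?Lfun2_mul_Lfun1 //.
  congr (fine (expectation _ _)); apply/funext => t /=.
  by rewrite /re /im; case: (U t) (V t) => [a b] [a' b'] /=; ring.
rewrite -fineB ?expectation_fin_num ?Lfun2_mul_Lfun1 // -expectationB ?Lfun2_mul_Lfun1 //.
congr (fine (expectation _ _)); apply/funext => t /=.
by rewrite /re /im; case: (U t) (V t) => [a b] [a' b'] /=; ring.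
Qed.

Lemma L2_0 : L2 P (fun=> 0).
Proof. by split; exact: Lfun2_0. Qed.

Lemma L2_lin (c : R[i]) U V : L2 P U -> L2 P V -> L2 P (fun t => c * U t + V t).
Proof.
case: c => a b [rU iU] [rV iV]; split.
  rewrite (_ : (fun t => _) = (fun t => a * re U t + (- b * im U t + re V t))).
    by apply: Lfun2_lin => //; exact: Lfun2_lin.
  apply/funext => t; rewrite /re /im.
  by case: (U t) (V t) => [x y] [x' y'] /=; ring.
rewrite (_ : (fun t => _) = (fun t => b * re U t + (a * im U t + im V t))).
  by apply: Lfun2_lin => //; exact: Lfun2_lin.
apply/funext => t; rewrite /re /im.
by case: (U t) (V t) => [x y] [x' y'] /=; ring.
Qed.

Lemma inner_lin (c : R[i]) U V W : L2 P U -> L2 P V -> L2 P W ->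
  inner P (fun t => c * U t + V t) W = c * inner P U W + inner P V W.
Proof.
move=> U2 V2 W2; have UV2 := L2_lin c U2 V2.
rewrite !innerE //.
case: c {UV2} => a b.
have [[[rU iU] [rV iV]] [rW iW]] := (U2, V2, W2).
have -> : re (fun t => (a +i* b) * U t + V t) = (fun t => a * re U t + (- b * im U t + re V t)).
  apply/funext => t; rewrite /re /im.
  by case: (U t) (V t) => [x y] [x' y'] /=; ring.
have -> : im (fun t => (a +i* b) * U t + V t) = (fun t => b * re U t + (a * im U t + im V t)).
  apply/funext => t; rewrite /re /im.
  by case: (U t) (V t) => [x y] [x' y'] /=; ring.
rewrite !rinner_lin ?Lfun2_lin //.
by congr (_ +i* _) => /=; ring.
Qed.

Lemma inner_conj U V : L2 P U -> L2 P V -> inner P U V = (inner P V U)^*%R.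
Proof.
move=> U2 V2; rewrite !innerE //= [rinner (re V) (re U)]rinnerC [rinner (im V) (im U)]rinnerC.
by rewrite [rinner (im V) (re U)]rinnerC [rinner (re V) (im U)]rinnerC; congr (_ +i* _); ring.
Qed.

Lemma norm2_sqr U : (norm2 P U ^+ 2)%:C = inner P U U.
Proof.
rewrite /norm2 sqr_sqrtr; last first.
  by rewrite fine_ge0 // expectation_ge0 // => t; exact: sqr_ge0.
rewrite /inner /cexpectation; congr (_ +i* _).
  congr (fine (expectation _ _)); apply/funext => t /=.
  case: (U t) => a b /=; rewrite sqr_sqrtr; first by ring.
  by rewrite addr_ge0 ?sqr_ge0.
rewrite (_ : (fun t => _) = cst 0) ?expectation_cst //.
by apply/funext => t /=; case: (U t) => a b /=; ring.
Qed.

Lemma norm2_ge0 U : 0 <= norm2 P U.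
Proof. exact: sqrtr_ge0. Qed.

(** (U,U) is the sum of the integrals of (Re U)^2 and (Im U)^2; both are nonnegative, so both
    vanish, and a nonnegative function with zero integral is zero almost everywhere. *)
Lemma inner_eq0_ae U : L2 P U -> inner P U U = 0 -> {ae P, forall t, U t = 0}.
Proof.
move=> U2; have [rU iU] := U2.
rewrite innerE // => -[+ _].
have ge0 f : 0 <= rinner f f.
  by rewrite fine_ge0 // expectation_ge0 // => t; rewrite /= -expr2 sqr_ge0.
have ae0 f : f \in Lfun P 2%:E -> rinner f f = 0 -> {ae P, forall t, f t = 0}.
  move=> f2 ff0.
  have ff := Lfun2_mul_Lfun1 f2 f2.
  have /Lfun1_integrable/measurable_int mff := ff.
  have : (\int[P]_(t in setT) `|(f t * f t)%:E| = 0)%E.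
    have : ('E_P[f \* f] = 0)%E.
      by rewrite -[LHS]fineK ?expectation_fin_num // -/(rinner f f) ff0.
    rewrite unlock => <-; apply: eq_integral => t _ /=.
    by rewrite ger0_norm // -expr2 sqr_ge0.
  move=> /(ae_eq_integral_abs P measurableT mff).
  apply: filterS => t /(_ I) /= [] /eqP.
  by rewrite mulf_eq0 orbb => /eqP.
move=> /eqP; rewrite paddr_eq0 // => /andP[/eqP r0 /eqP i0].
have := ae0 _ iU i0; have := ae0 _ rU r0.
apply: filterS2 => t; rewrite /re /im.
by case: (U t) => a b /= -> ->.
Qed.

(** Members of a span equal their linear combination only almost everywhere; this allows the
    combination to be substituted inside an inner product. *)
Lemma inner_ae U V W : L2 P U -> L2 P V -> L2 P W ->
  {ae P, forall t, U t = V t} -> inner P U W = inner P V W.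
Proof.
move=> U2 V2 W2 UV; rewrite !innerE //.
have [[[rU iU] [rV iV]] [rW iW]] := (U2, V2, W2).
have eq f g h : f \in Lfun P 2%:E -> g \in Lfun P 2%:E -> h \in Lfun P 2%:E ->
  {ae P, forall t, f t = g t} -> rinner f h = rinner g h.
  move=> f2 g2 h2 fg; rewrite /rinner unlock; congr fine; apply: ae_eq_integral => //.
  - by have /Lfun1_integrable/measurable_int := Lfun2_mul_Lfun1 f2 h2.
  - by have /Lfun1_integrable/measurable_int := Lfun2_mul_Lfun1 g2 h2.
  - by apply: filterS fg => t /= -> _.
have rUV : {ae P, forall t, re U t = re V t} by apply: filterS UV => t; rewrite /re => ->.
have iUV : {ae P, forall t, im U t = im V t} by apply: filterS UV => t; rewrite /im => ->.
by rewrite (eq _ _ _ rU rV rW rUV) (eq _ _ _ iU iV iW iUV)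
  (eq _ _ _ rU rV iW rUV) (eq _ _ _ iU iV rW iUV).
Qed.

End inner_product.

(** * Linear combinations, spans and orthogonal projections *)

Section sums.
Context {d : measure_display} {T : measurableType d} {R : realType}.
Variable P : probability T R.
Implicit Types (U V W : T -> R[i]).

Lemma L2_sub U V : L2 P U -> L2 P V -> L2 P (fun t => U t - V t).
Proof.
move=> U2 V2; rewrite (_ : (fun t => _) = fun t => -1 * V t + U t).
  exact: L2_lin.
by apply/funext => t; ring.
Qed.

Lemma L2_scale (c : R[i]) U : L2 P U -> L2 P (fun t => c * U t).
Proof.
move=> U2; rewrite (_ : (fun t => _) = fun t => c * U t + 0).
  by apply: L2_lin => //; exact: L2_0.
by apply/funext => t; ring.
Qed.

Lemma inner0l W : L2 P W -> inner P (fun=> 0) W = 0.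
Proof.
move=> W2.
have -> : (fun=> 0) = (fun t : T => -1 * 0 + 0) :> (T -> R[i]).
  by apply/funext => t; rewrite mulr0 addr0.
by rewrite (inner_lin (-1) (L2_0 P) (L2_0 P) W2); ring.
Qed.

Lemma inner_subl U V W : L2 P U -> L2 P V -> L2 P W ->
  inner P (fun t => U t - V t) W = inner P U W - inner P V W.
Proof.
move=> U2 V2 W2; rewrite (_ : (fun t => _) = fun t => -1 * V t + U t).
  by rewrite inner_lin //; ring.
by apply/funext => t; ring.
Qed.

Lemma inner_scalel (c : R[i]) U W : L2 P U -> L2 P W ->
  inner P (fun t => c * U t) W = c * inner P U W.
Proof.
move=> U2 W2; rewrite (_ : (fun t => _) = fun t => c * U t + 0).
  by rewrite inner_lin ?inner0l ?addr0 //; exact: L2_0.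
by apply/funext => t; ring.
Qed.

Lemma L2_sum I (r : seq I) (c : I -> R[i]) (F : I -> T -> R[i]) :
  (forall i, L2 P (F i)) -> L2 P (fun t => \sum_(i <- r) c i * F i t).
Proof.
move=> F2; elim: r => [|i r ih].
  rewrite (_ : (fun t => _) = fun=> 0); first exact: L2_0.
  by apply/funext => t; rewrite big_nil.
rewrite (_ : (fun t => _) = fun t => c i * F i t + \sum_(i <- r) c i * F i t).
  exact: L2_lin.
by apply/funext => t; rewrite big_cons.
Qed.

Lemma inner_suml I (r : seq I) (c : I -> R[i]) (F : I -> T -> R[i]) W :
  (forall i, L2 P (F i)) -> L2 P W ->
  inner P (fun t => \sum_(i <- r) c i * F i t) W =
  \sum_(i <- r) c i * inner P (F i) W.
Proof.
move=> F2 W2; elim: r => [|i r ih].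
  rewrite big_nil (_ : (fun t => _) = fun=> 0); first exact: inner0l.
  by apply/funext => t; rewrite big_nil.
rewrite (_ : (fun t => _) = fun t => c i * F i t + \sum_(i <- r) c i * F i t).
  by rewrite inner_lin // ?big_cons ?ih //; exact: L2_sum.
by apply/funext => t; rewrite big_cons.
Qed.

Lemma inner_sumr I (r : seq I) (c : I -> R[i]) (F : I -> T -> R[i]) W :
  (forall i, L2 P (F i)) -> L2 P W ->
  inner P W (fun t => \sum_(i <- r) c i * F i t) =
  \sum_(i <- r) (c i)^*%R * inner P W (F i).
Proof.
move=> F2 W2; rewrite inner_conj ?inner_suml //; last exact: L2_sum.
rewrite rmorph_sum; apply: eq_bigr => i _.
by rewrite rmorphM /= -inner_conj.
Qed.

Variable X : int -> T -> R[i].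
Hypothesis X2 : forall k, L2 P (X k).

Lemma sp_X (K : set int) k : K k -> sp P X K (X k).
Proof.
move=> Kk; split => //; exists [:: k]; exists (fun=> 1).
  by move=> j; rewrite inE => /eqP ->.
by apply: aeW => t; rewrite big_seq1 mul1r.
Qed.

Lemma sp0 (K : set int) : sp P X K (fun=> 0).
Proof.
split; first exact: L2_0.
by exists [::]; exists (fun=> 0) => //; apply: aeW => t; rewrite big_nil.
Qed.

Lemma sp_sub (K K' : set int) : K `<=` K' -> sp P X K `<=` sp P X K'.
Proof.
move=> KK' U [U2 [s [c sK Us]]]; split => //; exists s; exists c => // k ks.
exact/KK'/sK.
Qed.

Lemma sp_ae (K : set int) U V : L2 P V -> {ae P, forall t, U t = V t} ->
  sp P X K U -> sp P X K V.
Proof.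
move=> V2 UV [U2 [s [c sK Us]]]; split => //; exists s; exists c => //.
by apply: filterS2 UV Us => t -> .
Qed.

(** The index lists in [sp] may contain repetitions; with multiplicities, two combinations can be
    written over one common duplicate-free list and added termwise. *)
Lemma sum_count (A : nmodType) (I : eqType) (s S : seq I) (F : I -> A) :
  uniq S -> {subset s <= S} ->
  \sum_(i <- s) F i = \sum_(i <- S) F i *+ count_mem i s.
Proof.
move=> uS; elim: s => [|i s ih] sS.
  by rewrite big_nil big1 // => i _; rewrite mulr0n.
rewrite big_cons ih; last by move=> j js; apply: sS; rewrite inE js orbT.
under [in RHS]eq_bigr do rewrite /= mulrnDr.
rewrite big_split /=; congr (_ + _).
rewrite (bigD1_seq i) ?sS ?inE ?eqxx //= big1 ?addr0 // => j.
by rewrite eq_sym => /negPf ->.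
Qed.

Lemma sp_lin (K : set int) (c : R[i]) U V : sp P X K U -> sp P X K V ->
  sp P X K (fun t => c * U t + V t).
Proof.
move=> [U2 [s [cU sK Us]]] [V2 [s' [cV s'K Vs]]]; split; first exact: L2_lin.
exists (undup (s ++ s')).
exists (fun k => c * (cU k *+ count_mem k s) + cV k *+ count_mem k s').
  by move=> k; rewrite mem_undup mem_cat => /orP[/sK|/s'K].
apply: filterS2 Us Vs => t -> ->.
have sS : {subset s <= undup (s ++ s')}.
  by move=> k ks; rewrite mem_undup mem_cat ks.
have s'S : {subset s' <= undup (s ++ s')}.
  by move=> k ks; rewrite mem_undup mem_cat ks orbT.
rewrite (sum_count _ (undup_uniq _) sS) (sum_count _ (undup_uniq _) s'S).
rewrite mulr_sumr -big_split /=; apply: eq_bigr => k _.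
by rewrite mulrDl -mulrA -!mulrnAl.
Qed.

(** All occurrences of k in the index list are collected into the single coefficient c; filtering
    them out leaves a list in K. *)
Lemma sp_split (K : set int) k U : sp P X (K `|` [set k]) U ->
  exists c : R[i], sp P X K (fun t => U t - c * X k t).
Proof.
move=> [U2 [s [c sK Us]]]; exists (\sum_(j <- s | j == k) c j).
split; first by apply: L2_sub => //; exact: L2_scale.
exists [seq j <- s | j != k]; exists c.
  by move=> j; rewrite mem_filter => /andP[/eqP jk /sK[//|]].
apply: filterS Us => t ->; rewrite big_filter.
rewrite mulr_suml (bigID (fun j => j == k)) /=.
have -> : \sum_(j <- s | j == k) c j * X j t = \sum_(j <- s | j == k) c j * X k t.
  by apply: eq_bigr => j /eqP ->.
by rewrite addrAC subrr add0r.
Qed.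

Lemma sp_lcomb (K : set int) I (r : seq I) (c : I -> R[i]) (F : I -> T -> R[i]) :
  (forall i, sp P X K (F i)) -> sp P X K (fun t => \sum_(i <- r) c i * F i t).
Proof.
move=> FK; elim: r => [|i r ih].
  rewrite (_ : (fun t => _) = fun=> 0); first exact: sp0.
  by apply/funext => t; rewrite big_nil.
rewrite (_ : (fun t => _) = fun t => c i * F i t + \sum_(i <- r) c i * F i t).
  exact: sp_lin.
by apply/funext => t; rewrite big_cons.
Qed.

Lemma inner_sp0 (K : set int) U V : L2 P U ->
  (forall k, K k -> inner P U (X k) = 0) -> sp P X K V -> inner P U V = 0.
Proof.
move=> U2 UX [V2 [s [c sK Vs]]].
have S2 := L2_sum s c X2.
rewrite inner_conj // (inner_ae V2 S2 U2 Vs) -inner_conj // inner_sumr //.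
by rewrite big_seq big1 // => k ks; rewrite UX ?mulr0 //; exact: sK.
Qed.

(** The condition under which [proj] chooses its value. Since [proj] falls back to 0 when no such V
    exists, a projection has to be exhibited before anything can be said about it. *)
Definition is_proj (K : set int) U V :=
  sp P X K V /\ forall W, sp P X K W -> inner P (fun t => U t - V t) W = 0.

Lemma proj_L2 K U : L2 P (Defs.proj P (sp P X K) U).
Proof.
by rewrite /Defs.proj; case: xgetP => [V _ [[]]//|_]; exact: L2_0.
Qed.

Lemma projP K U V : is_proj K U V -> is_proj K U (Defs.proj P (sp P X K) U).
Proof.
by move=> KUV; rewrite /Defs.proj; case: xgetP => [W _ //|/(_ V) nV]; case: nV.
Qed.

(** The difference D of the two projections lies in the span, so both residuals are orthogonal to it
    and (D,D) = 0. *)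
Lemma is_proj_uniq K U V V' : L2 P U -> is_proj K U V -> is_proj K U V' ->
  {ae P, forall t, V t = V' t}.
Proof.
move=> U2 [KV oV] [KV' oV'].
have [[V2 _] [V'2 _]] := (KV, KV').
pose D t := -1 * V' t + V t.
have KD : sp P X K D by exact: sp_lin.
have D2 : L2 P D by case: KD.
have : inner P D D = 0.
  have := oV' _ KD; rewrite inner_subl // => E'.
  have := oV _ KD; rewrite inner_subl // => E.
  rewrite {1}/D inner_lin //.
  have -> : inner P V D = inner P U D by apply/eqP; rewrite -subr_eq0 -oppr_eq0 opprB E.
  have -> : inner P V' D = inner P U D by apply/eqP; rewrite -subr_eq0 -oppr_eq0 opprB E'.
  by ring.
move=> /(inner_eq0_ae D2); apply: filterS => t.
by rewrite /D mulN1r addrC => /subr0_eq.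
Qed.

End sums.

Lemma sum_delta (A : pzRingType) n l (c : nat -> A) : (l < n)%N ->
  \sum_(k < n) c k * (k == l :> nat)%:R = c l.
Proof.
move=> ln; rewrite (bigD1 (Ordinal ln)) //= eqxx mulr1 big1 ?addr0 // => k kl.
by rewrite -(inj_eq val_inj) /= in kl; rewrite (negPf kl) mulr0.
Qed.

(** * Gram-Schmidt orthonormalization from time -m onwards *)

Section gram_schmidt.
Context {d : measure_display} {T : measurableType d} {R : realType}.
Variables (P : probability T R) (X : int -> T -> R[i]).
Hypothesis X2 : forall k, L2 P (X k).
Hypothesis XND : forall j, ~ clsp P X (past j) (X j).

(** A residual of norm 0 would put X_j in the closed span of its past. This makes the division by
    the norm in each innovation legitimate. *)
Lemma residual_norm_gt0 (K : set int) j V : K `<=` past j -> sp P X K V ->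
  0 < norm2 P (fun t => X j t - V t).
Proof.
move=> Kj KV; rewrite lt0r norm2_ge0 andbT; apply/eqP => n0.
case: (@XND j); split => // e e0; exists V; first exact: (sp_sub Kj).
by rewrite n0.
Qed.

Variable m : nat.

(** Times are shifted by m so that the window starts at position 0 and induction runs over the
    natural numbers. *)
Let Z (k : nat) := X (k%:Z - m%:Z).
Let eps (k : nat) := finite_innovation P X m (k%:Z - m%:Z).
Let I (k : nat) : set int := [set i | - m%:Z <= i < k%:Z - m%:Z].

Let I_sub k l : (k <= l)%N -> I k `<=` I l.
Proof. by move=> kl i; rewrite /I /=; lia. Qed.

Let Z_mem k l : (k < l)%N -> sp P X (I l) (Z k).
Proof. by move=> kl; apply: sp_X => //; rewrite /I /=; lia. Qed.

Let I_succ k : I k.+1 `<=` I k `|` [set k%:Z - m%:Z].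
Proof.
move=> i; rewrite /I /= => h; case: (eqVneq i (k%:Z - m%:Z)) => [->|/eqP ne]; first by right.
by left; rewrite /=; lia.
Qed.

Lemma finite_innovation_L2 j : L2 P (finite_innovation P X m j).
Proof.
have n2 U : L2 P U -> L2 P (normalize P U).
  move=> U2; rewrite (_ : normalize P U = fun t => ((norm2 P U)%:C)^-1 * U t).
    exact: L2_scale.
  by apply/funext => t; rewrite /normalize mulrC.
rewrite /finite_innovation; case: ifP => _; apply: n2 => //.
by apply: L2_sub => //; exact: proj_L2.
Qed.

Let eps2 k : L2 P (eps k). Proof. exact: finite_innovation_L2. Qed.
Let Z2 k : L2 P (Z k). Proof. exact: X2. Qed.

(** In the construction nu is the norm of the residual of Z k, so that nu eps_k is the residual and
    Z k - nu eps_k the projection. *)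
Let spec k := exists2 nu : R, 0 < nu &
  sp P X (I k) (fun t => Z k t - nu%:C * eps k t) /\
  (inner P (eps k) (eps k) = 1 /\
   forall W, sp P X (I k) W -> inner P (eps k) W = 0).

Let spec_of_proj k V : is_proj P X (I k) (Z k) V -> spec k.
Proof.
move=> kV.
(* The separate first case of [finite_innovation] is absorbed here: for k = 0 the set I k is empty
   and V' = 0 is the projection. *)
have [V' [V'I V'o] epsE] : exists2 V', is_proj P X (I k) (Z k) V' &
    eps k = normalize P (fun t => Z k t - V' t).
  rewrite /eps /finite_innovation; case: ifP => [/eqP k0|_].
    exists (fun=> 0); last first.
      by congr normalize; apply/funext => t; rewrite subr0.
    split; first exact: sp0.
    move=> W WI; rewrite (_ : (fun t => _) = Z k); last first.
      by apply/funext => t; rewrite subr0.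
    have [W2 _] := WI.
    by apply: (inner_sp0 X2 _ _ WI) => // i; rewrite /I /=; lia.
  by exists (predictor P X (k%:Z - m%:Z) (I k)) => //; exact: projP kV.
have [V'2 _] := V'I.
set r := fun t => Z k t - V' t.
have r2 : L2 P r by exact: L2_sub.
have nu0 : 0 < norm2 P r.
  by apply: (@residual_norm_gt0 (I k)) => // i; rewrite /I /past /=; lia.
have nuC : (norm2 P r)%:C != 0 by rewrite (inj_eq (@complexI R)) gt_eqF.
have epsr : eps k = fun t => ((norm2 P r)%:C)^-1 * r t.
  by rewrite epsE; apply/funext => t; rewrite /normalize mulrC.
exists (norm2 P r) => //; split; last split.
- rewrite (_ : (fun t => _) = V') //.
  by apply/funext => t; rewrite epsr mulVKf // /r; ring.
- rewrite epsr inner_scalel //; last exact: L2_scale.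
  rewrite [inner _ r _]inner_conj // ?inner_scalel //; last exact: L2_scale.
  have conjR (x : R) : (x%:C)^*%R = x%:C by exact: conjc_real.
  rewrite -norm2_sqr rmorphM fmorphV /= !conjR rmorphXn /=.
  by rewrite mulrA -invfM -expr2 mulVf // expf_neq0.
- move=> W WI; have [W2 _] := WI.
  by rewrite epsr inner_scalel // V'o // mulr0.
Qed.

Let expansion n := forall U, sp P X (I n) U ->
  {ae P, forall t, U t = \sum_(k < n) inner P U (eps k) * eps k t}.

Let eps_mem k l : (k < l)%N -> spec k -> sp P X (I l) (eps k).
Proof.
move=> kl [nu nu0 [Ik _]].
have Ik' : sp P X (I l) (fun t => Z k t - nu%:C * eps k t).
  by apply: sp_sub Ik; exact/I_sub/ltnW.
have nuC : nu%:C != 0 by rewrite (inj_eq (@complexI R)) gt_eqF.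
rewrite (_ : eps k = fun t => - (nu%:C)^-1 * (Z k t - nu%:C * eps k t) +
    ((nu%:C)^-1 * Z k t + 0)).
  by apply: sp_lin => //; apply: sp_lin; [exact: Z_mem|exact: sp0].
apply/funext => t; rewrite mulrBr !mulNr opprK mulKf //; ring.
Qed.

Let eps_ortho k l : spec k -> spec l -> inner P (eps k) (eps l) = (k == l)%:R.
Proof.
move=> sk sl; have [[_ _ [_ [nk ok]]] [_ _ [_ [_ ol]]]] := (sk, sl).
case: ltngtP => [kl|lk|->]; last by case: sl => ? _ [_ []].
- by rewrite inner_conj // ol ?conjC0 //; exact: eps_mem.
- by rewrite ok //; exact: eps_mem.
Qed.

(** Both halves are proved together: the expansion at n shows that the projection of Z n exists,
    which validates eps_n, and eps_n in turn extends the expansion to n+1. *)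
Let gram_schmidt n : (forall k, (k < n)%N -> spec k) /\ expansion n.
Proof.
elim: n => [|n [sn en]].
  split=> // U [U2 [[|k s] [c sI Us]]].
    by apply: filterS Us => t ->; rewrite big_nil big_ord0.
  by have := sI k; rewrite inE eqxx => /(_ isT); rewrite /I /=; lia.
(* The projection of Z n is its Fourier sum over the earlier innovations. *)
pose V t := \sum_(k < n) inner P (Z n) (eps k) * eps k t.
have V2 : L2 P V by exact: L2_sum.
have VI : sp P X (I n) V.
  by apply: sp_lcomb => // k; apply: eps_mem => //; exact: sn.
have Vo l : (l < n)%N -> inner P V (eps l) = inner P (Z n) (eps l).
  move=> ln; rewrite inner_suml // -(sum_delta (fun k => inner P (Z n) (eps k)) ln).
  by apply: eq_bigr => k _; rewrite eps_ortho //; exact: sn.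
have specn : spec n.
  apply: (@spec_of_proj _ V); split => // W WI; have [W2 _] := WI.
  have S2 : L2 P (fun t => \sum_(k < n) inner P W (eps k) * eps k t) by exact: L2_sum.
  have D2 : L2 P (fun t => Z n t - V t) by exact: L2_sub.
  rewrite inner_conj // (inner_ae W2 S2 D2 (en _ WI)) -inner_conj // inner_sumr //.
  by rewrite big1 // => k _; rewrite inner_subl // Vo // subrr mulr0.
have sS k : (k < n.+1)%N -> spec k.
  by rewrite ltnS leq_eqVlt => /orP[/eqP ->//|/sn].
split=> // U UI; have [U2 _] := UI.
have [c UcI] := sp_split X2 (sp_sub (@I_succ n) UI).
have [nu nu0 [ZI [nn on]]] := specn.
(* Trading Z n for nu eps_n leaves U = c nu eps_n + W with W in the smaller span, where the
   induction hypothesis applies. *)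
pose W t := c * (Z n t - nu%:C * eps n t) + (U t - c * Z n t).
have WI : sp P X (I n) W by exact: sp_lin.
have [W2 _] := WI.
have UE : U = fun t => c * nu%:C * eps n t + W t.
  by apply/funext => t; rewrite /W; ring.
have cE : inner P U (eps n) = c * nu%:C.
  by rewrite UE inner_lin // nn inner_conj // on // conjC0; ring.
apply: filterS (en _ WI) => t Wt.
rewrite big_ord_recr /= cE {1}UE addrC Wt; congr (_ + _).
apply: eq_bigr => k _; rewrite UE inner_lin // eps_ortho ?sS //; last first.
  exact: sn.
by rewrite gtn_eqF // mulr0 add0r.
Qed.

Lemma finite_innovation_ortho k l :
  inner P (finite_innovation P X m (k%:Z - m%:Z))
          (finite_innovation P X m (l%:Z - m%:Z)) = (k == l)%:R.
Proof.
have [sp _] := gram_schmidt (maxn k l).+1.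
by apply: eps_ortho; apply: sp; rewrite ltnS ?leq_maxl ?leq_maxr.
Qed.

(* For m = 0 this is the coefficient b_{j-k,j}. *)
Definition window_MA (j k : nat) : R[i] :=
  inner P (X (j%:Z - m%:Z)) (finite_innovation P X m (k%:Z - m%:Z)).

Lemma window_MA_eq0 j k : (j < k)%N -> window_MA j k = 0.
Proof.
move=> jk; have [/(_ k (ltnSn k)) [_ _ [_ [_ o]]] _] := gram_schmidt k.+1.
by rewrite /window_MA inner_conj // ?o ?conjC0 //; [exact: Z_mem|exact: eps2].
Qed.

(** Z k - nu eps_k is orthogonal to eps_k, so the diagonal entry is nu. *)
Lemma window_MA_diag_gt0 k : 0 < window_MA k k.
Proof.
have [/(_ k (ltnSn k)) [nu nu0 [ZI [n1 o]]] _] := gram_schmidt k.+1.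
have [D2 _] := ZI.
have := o _ ZI; rewrite inner_conj // inner_subl //; last exact: L2_scale.
rewrite inner_scalel // n1 mulr1 -[window_MA k k]/(inner P (Z k) (eps k)).
move=> /eqP; rewrite conjC_eq0 subr_eq0 => /eqP ->.
by rewrite ltcR.
Qed.

Lemma window_MA_expansion j n : (j < n)%N ->
  {ae P, forall t, X (j%:Z - m%:Z) t =
    \sum_(k < n) window_MA j k * finite_innovation P X m (k%:Z - m%:Z) t}.
Proof. by move=> jn; have [_] := gram_schmidt n; apply; exact: Z_mem. Qed.

(** Only X_{j-m} is expanded in the innovations, hence the bound on j alone. *)
Lemma window_MA_gram i j n : (j < n)%N ->
  inner P (X (i%:Z - m%:Z)) (X (j%:Z - m%:Z)) =
  \sum_(k < n) window_MA i k * (window_MA j k)^*%R.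
Proof.
move=> jn.
have S2 : L2 P (fun t => \sum_(k < n) window_MA j k * eps k t) by exact: L2_sum.
rewrite inner_conj // (inner_ae _ S2 _ (window_MA_expansion jn)) // -inner_conj //.
by rewrite inner_sumr //; apply: eq_bigr => k _; rewrite mulrC.
Qed.

End gram_schmidt.

(** * Triangular matrices: Cholesky uniqueness and inverses *)

Section triangular.
Variable C : numClosedFieldType.
Implicit Types (a b : nat -> nat -> C).

(** Strong induction on the column j: once the earlier columns cancel, the Gram identity leaves b_ij
    b_jj = b'_ij b'_jj. The case i = j and positivity give b_jj = b'_jj, by which one then
    divides. *)
Lemma cholesky_uniq b b' : (forall k, 0 < b k k) -> (forall k, 0 < b' k k) ->
  (forall i j, (j <= i)%N ->
    \sum_(k < j.+1) b i k * (b j k)^* = \sum_(k < j.+1) b' i k * (b' j k)^*) ->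
  forall i j, (j <= i)%N -> b i j = b' i j.
Proof.
move=> b0 b'0 G i j; elim/ltn_ind: j i => j ih.
have step i : (j <= i)%N -> b i j * b j j = b' i j * b' j j.
  move=> ji; have := G i j ji; rewrite !big_ord_recr /=.
  rewrite (eq_bigr (fun k : 'I_j => b' i k * (b' j k)^*)).
    by rewrite !(conj_Creal (gtr0_real _)) // => /addrI.
  move=> k _; rewrite !ih //; first exact: ltnW.
  by apply: leq_trans ji; exact: ltnW.
have bjj : b j j = b' j j.
  by apply: (@pexpIrn _ 2) => //; rewrite ?nnegrE ?ltW // !expr2 step.
move=> i ji; have := step i ji; rewrite bjj; apply: mulIf.
by rewrite gt_eqF.
Qed.

(** The zero above the diagonal has to be explicit: truncated subtraction would otherwise yield
    a_{0,k} there. *)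
Definition AR_matrix a (k i : nat) : C := if (i <= k)%N then a (k - i)%N k else 0.

(** The defining sum over i <= k <= j is padded to the full range: [AR_matrix] vanishes for k < i
    and b for k > j. *)
Lemma AR_matrix_right_inv b a m : (forall j k, (j < k)%N -> b j k = 0) ->
  (forall i j, (i <= j)%N ->
    \sum_(i <= k < j.+1) b j k * a (k - i)%N k = (i == j)%:R) ->
  forall j i, (j <= m)%N ->
  \sum_(k < m.+1) b j k * AR_matrix a k i = (j == i)%:R.
Proof.
move=> bu ba j i jm; case: (leqP i j) => ij; last first.
  rewrite ltn_eqF // big1 // => k _; rewrite /AR_matrix.
  case: leqP => ik; last by rewrite mulr0.
  by rewrite bu ?mul0r //; exact: leq_trans ik.
rewrite eq_sym -ba // (big_nat_widen _ _ m.+1) // (big_nat_widenl _ 0) //=.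
rewrite big_mkord [RHS]big_mkcond /=; apply: eq_bigr => k _.
rewrite /AR_matrix ltnS; case: (leqP i k) => ik; last by rewrite andbF mulr0.
by rewrite andbT; case: leqP => // jk; rewrite bu // mul0r.
Qed.

(** A right inverse of a finite square matrix is also a left inverse. *)
Lemma AR_matrix_left_inv b a m : (forall j k, (j < k)%N -> b j k = 0) ->
  (forall i j, (i <= j)%N ->
    \sum_(i <= k < j.+1) b j k * a (k - i)%N k = (i == j)%:R) ->
  forall j i, (j <= m)%N -> (i <= m)%N ->
  \sum_(k < m.+1) AR_matrix a j k * b k i = (j == i)%:R.
Proof.
move=> bu ba j i; rewrite -(ltnS j) -(ltnS i) => jm im.
pose B := \matrix_(j < m.+1, k < m.+1) b j k.
pose A := \matrix_(k < m.+1, i < m.+1) AR_matrix a k i.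
have BA : B *m A = 1%:M.
  apply/matrixP => j' i'; rewrite !mxE.
  have j'm : (j' <= m)%N by rewrite -ltnS.
  rewrite -(AR_matrix_right_inv bu ba i' j'm).
  by apply: eq_bigr => k _; rewrite !mxE.
have /matrixP/(_ (Ordinal jm) (Ordinal im)) := mulmx1C BA.
rewrite !mxE => <-.
by apply: eq_bigr => k _; rewrite !mxE.
Qed.

(** Converts sums over window positions into the form of the theorem, which counts backwards from
    time 0. *)
Lemma sum_rev_support (A : nmodType) (G : nat -> A) m u : (u <= m)%N ->
  (forall k, (k < m - u)%N -> G k = 0) ->
  \sum_(k < m.+1) G k = \sum_(0 <= k < u.+1) G (m - k)%N.
Proof.
move=> um G0; rewrite -(big_mkord xpredT G).
rewrite (@big_cat_nat _ _ _ (m - u)) //=; last by lia.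
rewrite big_nat_cond big1 ?add0r; last first.
  by move=> k /andP[/andP[_ km] _]; exact: G0.
rewrite big_nat_rev /= -{1}[(m - u)%N]add0n big_addn.
rewrite (_ : (m.+1 - (m - u) = u.+1)%N); last by lia.
rewrite !big_nat; apply: eq_bigr => k /andP[_ ku]; congr G; lia.
Qed.

End triangular.

(** * Stationarity, the AR coefficients and the interpolation residual *)

Section stationary.
Context {d : measure_display} {T : measurableType d} {R : realType}.
Variables (P : probability T R) (X : int -> T -> R[i]).
Hypothesis X2 : forall k, L2 P (X k).
Hypothesis XND : forall j, ~ clsp P X (past j) (X j).
Hypothesis Xs : weakly_stationary P X.

Lemma window_MA_shift m j k : window_MA P X m j k = window_MA P X 0 j k.
Proof.
case: (leqP k j) => kj; last by rewrite !window_MA_eq0.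
apply: cholesky_uniq kj; try exact: window_MA_diag_gt0.
move=> i l li; rewrite -!(@window_MA_gram _ _ _ P X) // -(Xs _ _ m%:Z).
by rewrite !subr0 !subrK.
Qed.

(** Carries the coefficients, defined on the window starting at 0, over to the window starting at
    -m, where the prediction takes place. *)
Lemma finite_MA_coefE m j k : (k <= j)%N ->
  finite_MA_coef P X (j - k) j = window_MA P X m j k.
Proof.
move=> kj; rewrite (window_MA_shift m) /window_MA /finite_MA_coef !subr0 subzn ?leq_subr //.
by rewrite subKn.
Qed.

Variable a : nat -> nat -> R[i].
Hypothesis ha : finite_AR_coefs P X a.
Variable m : nat.

Lemma window_MA_AR i j : (i <= j)%N ->
  \sum_(i <= k < j.+1) window_MA P X m j k * a (k - i)%N k = (i == j)%:R.
Proof.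
move=> ij; rewrite -(ha ij) !big_nat; apply: eq_bigr => k /andP[_ kj].
by rewrite -finite_MA_coefE.
Qed.

(** The diagonal of the triangular system reads b_{0,k} a_{0,k} = 1. *)
Lemma AR0_neq0 k : a 0%N k != 0.
Proof.
have := window_MA_AR (leqnn k); rewrite big_nat1 subnn eqxx => /eqP.
by apply: contraTneq => ->; rewrite mulr0 eq_sym oner_neq0.
Qed.

(** The expansions of the m+1 variables hold off one common null set, where the left inverse of B
    solves them for the innovations. *)
Lemma finite_innovation_AR k : (k <= m)%N ->
  {ae P, forall t, finite_innovation P X m (k%:Z - m%:Z) t =
    \sum_(i < m.+1) AR_matrix a k i * X (i%:Z - m%:Z) t}.
Proof.
move=> km.
have : {ae P, forall t, forall i : 'I_m.+1, X (i%:Z - m%:Z) t =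
    \sum_(l < m.+1) window_MA P X m i l * finite_innovation P X m (l%:Z - m%:Z) t}.
  by apply: filter_forall => i; exact: window_MA_expansion.
apply: filterS => t ZE.
under eq_bigr do rewrite ZE mulr_sumr.
rewrite exchange_big /=.
have AB l : (l <= m)%N -> \sum_(i < m.+1) AR_matrix a k i * window_MA P X m i l = (k == l)%:R.
  by apply: AR_matrix_left_inv km => // *; [exact: window_MA_eq0|exact: window_MA_AR].
have km1 : (k < m.+1)%N by [].
rewrite -[LHS](sum_delta (fun l => finite_innovation P X m (l%:Z - m%:Z) t) km1).
apply: eq_bigr => l _; rewrite eq_sym -AB -1?ltnS //.
by rewrite mulr_sumr; apply: eq_bigr => i _; rewrite mulrC mulrA.
Qed.

Variable g : nat -> R[i].
Let r t := \sum_(k < m.+1) g k * finite_innovation P X m (k%:Z - m%:Z) t.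

Lemma innovation_comb_inner j : (j <= m)%N ->
  inner P (X (j%:Z - m%:Z)) r = \sum_(k < m.+1) (g k)^*%R * window_MA P X m j k.
Proof.
by move=> jm; rewrite inner_sumr // => k; exact: finite_innovation_L2.
Qed.

Lemma innovation_comb_AR :
  {ae P, forall t, r t =
    \sum_(i < m.+1) (\sum_(k < m.+1) g k * AR_matrix a k i) * X (i%:Z - m%:Z) t}.
Proof.
have : {ae P, forall t, forall k : 'I_m.+1,
    finite_innovation P X m (k%:Z - m%:Z) t =
    \sum_(i < m.+1) AR_matrix a k i * X (i%:Z - m%:Z) t}.
  by apply: filter_forall => k; apply: finite_innovation_AR; rewrite -ltnS.
apply: filterS => t EE; rewrite /r.
under eq_bigr do rewrite EE mulr_sumr.
rewrite exchange_big /=; apply: eq_bigr => i _.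
by rewrite mulr_suml; apply: eq_bigr => k _; rewrite mulrA.
Qed.

(** The two coefficient conditions say that X_0 - r involves only X_k with k in K; the last
    condition says that r is orthogonal to these. Hence X_0 - r is the projection, and the error is
    (r,r) = (r,X_0). *)
Lemma interpolation_residual p (K : set int) :
  (p < m)%N ->
  (forall k, K k <-> exists2 j : nat, k = j%:Z - m%:Z & (j < m)%N && (j != p)) ->
  \sum_(k < m.+1) g k * AR_matrix a k m = 1 ->
  \sum_(k < m.+1) g k * AR_matrix a k p = 0 ->
  (forall j, (j < m)%N -> j != p ->
    \sum_(k < m.+1) (g k)^*%R * window_MA P X m j k = 0) ->
  {ae P, forall t, X 0 t - predictor P X 0 K t = r t} /\
  (pred_error P X K)%:C = (\sum_(k < m.+1) (g k)^*%R * window_MA P X m m k)^*%R.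
Proof.
move=> pm KE gm gp go.
have X0 : X 0 = X (m%:Z - m%:Z) by rewrite subrr.
have r2 : L2 P r by apply: L2_sum => k; exact: finite_innovation_L2.
have rK W : sp P X K W -> inner P r W = 0.
  apply: inner_sp0 => // k /KE[j -> /andP[jm jp]].
  by rewrite inner_conj // innovation_comb_inner ?go ?conjC0 // ltnW.
pose V t := X 0 t - r t.
have V2 : L2 P V by exact: L2_sub.
have VK : sp P X K V.
  (* Positions m and p carry coefficient 0 in X_0 - r, so the zero function may stand there and
     every term lies in the span. *)
  pose F (i : 'I_m.+1) := if (i < m)%N && (i != p :> nat)
    then X (i%:Z - m%:Z) else fun=> 0.
  have FK i : sp P X K (F i).
    rewrite /F; case: ifP => h; last exact: sp0.
    by apply: sp_X => //; apply/KE; exists i.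
  apply: (@sp_ae _ _ _ _ _ _ (fun t => \sum_(i < m.+1)
      - (\sum_(k < m.+1) g k * AR_matrix a k i) * F i t)) => //; last first.
    exact: sp_lcomb.
  apply: filterS innovation_comb_AR => t rE.
  rewrite /V rE big_ord_recr [in RHS]big_ord_recr /= gm mul1r X0 /F /= ltnn /=.
  rewrite mulr0 addr0 opprD addrCA subrr addr0 -sumrN; apply: eq_bigr => i _ /=.
  rewrite ltn_ord /=; case: eqP => [->|_] /=; last by rewrite mulNr.
  by rewrite gp !mul0r oppr0 mul0r.
have Vr t : X 0 t - V t = r t by rewrite /V opprB addrC subrK.
have VP : is_proj P X K (X 0) V.
  split=> // W WK; rewrite (_ : (fun t => _) = r) ?rK //.
  by apply/funext.
have predP := projP VP.
have E : {ae P, forall t, X 0 t - predictor P X 0 K t = r t}.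
  apply: filterS (is_proj_uniq (X2 0) VP predP) => t Vt.
  by rewrite /predictor -Vt.
split=> //.
have pred2 : L2 P (predictor P X 0 K) by exact: proj_L2.
have D2 : L2 P (fun t => X 0 t - predictor P X 0 K t) by exact: L2_sub.
have predr : inner P (predictor P X 0 K) r = 0.
  by rewrite inner_conj // rK ?conjC0 //; case: predP.
rewrite /pred_error norm2_sqr (inner_ae D2 r2 D2 E) inner_conj // inner_subl //.
by rewrite predr subr0 X0 innovation_comb_inner.
Qed.

End stationary.

(** * Explicit solution of the 2 x 2 system for the residual *)

Unset Implicit Arguments.

Theorem mainTheorem6 (d : measure_display) (T : measurableType d)
    (R : realType) (P : probability T R) (X : int -> T -> R[i])
    (hX0 : zero_mean_process P X) (hXs : weakly_stationary P X)
    (hXp : purely_nondeterministic P X)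
    (a : nat -> nat -> R[i]) (ha : finite_AR_coefs P X a)
    (m u : nat) (hm : (0 < m)%N) (hu : (1 <= u <= m)%N) :
  let K : set int := [set k | - m%:Z <= k <= -1 /\ k <> - u%:Z] in
  let Delta : R[i] :=
    `|a 0%N m| ^+ 2 * \sum_(1 <= k < u.+1) `|a (u - k)%N (m - k)%N| ^+ 2 in
  let alpha0 : R[i] :=
    Delta^-1 * \sum_(0 <= k < u.+1) `|a (u - k)%N (m - k)%N| ^+ 2 in
  let alphau : R[i] := - ((a 0%N m)^*%R * a u m / Delta) in
  (pred_error P X K)%:C =
    (\sum_(0 <= k < u.+1) `|a (u - k)%N (m - k)%N| ^+ 2)
    / (`|a 0%N m| ^+ 2 * \sum_(1 <= k < u.+1) `|a (u - k)%N (m - k)%N| ^+ 2)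
  /\
  {ae P, forall t : T,
    X 0 t - predictor P X 0 K t =
      alpha0 * (a 0%N m)^*%R * finite_innovation P X m 0 t
      + alphau * \sum_(0 <= k < u.+1)
          (a (u - k)%N (m - k)%N)^*%R * finite_innovation P X m (- k%:Z) t}.
Proof.
move=> K Delta alpha0 alphau.
have X2 k : L2 P (X k) by case: (hX0 k).
have XND j : ~ clsp P X (past j) (X j) by case: (hXp j).
have /andP[u0 um] := hu.
(* The position of X_{-u} in the shifted window. *)
pose p := (m - u)%N.
have pm : (p < m)%N by rewrite /p; lia.
pose A := AR_matrix a.
have Amm : A m m = a 0%N m by rewrite /A /AR_matrix leqnn subnn.
have Amp : A m p = a u m by rewrite /A /AR_matrix leq_subr subKn.
(* Column m of A reduces to its diagonal entry, so Y_m is a multiple of the last innovation. *)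
have A0 k : (k < m)%N -> A k m = 0 by move=> km; rewrite /A /AR_matrix leqNgt km.
have sumA (F : nat -> R[i]) : \sum_(k < m.+1) F k * A k m = F m * a 0%N m.
  rewrite big_ord_recr /= Amm big1 ?add0r // => k _.
  by rewrite A0 ?mulr0.
have sumAc (F : nat -> R[i]) : \sum_(k < m.+1) F k * (A k m)^*%R = F m * (a 0%N m)^*%R.
  rewrite big_ord_recr /= Amm big1 ?add0r // => k _.
  by rewrite A0 ?conjC0 ?mulr0.
have sumAp (F : nat -> R[i]) : \sum_(k < m.+1) (A k p)^*%R * F k =
    \sum_(0 <= k < u.+1) (a (u - k)%N (m - k)%N)^*%R * F (m - k)%N.
  rewrite (@sum_rev_support _ (fun k => (A k p)^*%R * F k) _ u) //; last first.
    by move=> k kp; rewrite /A /AR_matrix leqNgt kp /= conjC0 mul0r.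
  rewrite !big_nat; apply: eq_bigr => k /andP[_ ku].
  rewrite /A /AR_matrix (_ : (p <= m - k)%N); last by rewrite /p; lia.
  by rewrite (_ : (m - k - p = u - k)%N) //; rewrite /p; lia.
pose S := \sum_(0 <= k < u.+1) `|a (u - k)%N (m - k)%N| ^+ 2.
pose S1 := \sum_(1 <= k < u.+1) `|a (u - k)%N (m - k)%N| ^+ 2.
have SE : S = `|a u m| ^+ 2 + S1 by rewrite /S big_ltn // !subn0.
(* The last term, k = u, is the squared modulus of the diagonal entry a_{0,m-u}. *)
have S1_gt0 : 0 < S1.
  rewrite /S1 big_nat_recr //= subnn ltr_wpDl ?exprn_gt0 ?normr_gt0 //.
    by apply: sumr_ge0 => k _; exact: exprn_ge0.
  exact: (AR0_neq0 X2 XND hXs ha).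
have a0 : a 0%N m != 0 by exact: (AR0_neq0 X2 XND hXs ha).
have DE : Delta = `|a 0%N m| ^+ 2 * S1 by [].
have alpha0E : alpha0 = Delta^-1 * S by [].
have Delta0 : Delta != 0.
  by rewrite DE mulf_neq0 ?expf_neq0 ?normr_eq0 // gt_eqF.
have AppS : \sum_(k < m.+1) (A k p)^*%R * A k p = S.
  rewrite (sumAp (fun k => A k p)) /S !big_nat; apply: eq_bigr => k /andP[_ ku].
  rewrite /A /AR_matrix (_ : (p <= m - k)%N); last by rewrite /p; lia.
  rewrite (_ : (m - k - p = u - k)%N); last by rewrite /p; lia.
  by rewrite normCK mulrC.
(* The coordinates of alpha'_0 Y_m + alpha'_{-u} Y_{m-u} in the innovations. *)
pose g k := alpha0 * (A k m)^*%R + alphau * (A k p)^*%R.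
have gsum (F : nat -> R[i]) : \sum_(k < m.+1) g k * F k =
    alpha0 * (\sum_(k < m.+1) (A k m)^*%R * F k) +
    alphau * (\sum_(k < m.+1) (A k p)^*%R * F k).
  rewrite !mulr_sumr -big_split /=; apply: eq_bigr => k _.
  by rewrite /g; ring.
have MA0 j i : (j <= m)%N -> \sum_(k < m.+1) window_MA P X m j k * A k i = (j == i)%:R.
  apply: AR_matrix_right_inv; first by move=> *; exact: window_MA_eq0.
  by move=> *; exact: window_MA_AR.
(* Duality (X_{j-m}, Y_i) = delta_ij; the conjugates come from the second argument of the inner
   product. *)
have gMA j : (j <= m)%N -> \sum_(k < m.+1) (g k)^*%R * window_MA P X m j k =
    alpha0^*%R * (j == m)%:R + alphau^*%R * (j == p)%:R.
  move=> jm; rewrite -!MA0 // !mulr_sumr -big_split /=; apply: eq_bigr => k _.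
  by rewrite /g rmorphD !rmorphM /= !conjCK; ring.
have [||| |eqX err] := @interpolation_residual _ _ _ P X X2 XND hXs a ha m g p K pm.
- move=> k; rewrite /K /p /=; split.
    move=> [kK ku]; exists (absz (k + m%:Z)); lia.
  by move=> [j -> jK]; split; lia.
(* Coefficient of X_0: |a_{0,m}|^2 (S - |a_{u,m}|^2) / Delta = |a_{0,m}|^2 S1 / Delta = 1. *)
- rewrite (gsum (fun k => A k m)) (sumA (fun k => (A k m)^*%R)).
  rewrite (sumA (fun k => (A k p)^*%R)) Amm Amp -(mulVf Delta0) {2}DE alpha0E /alphau SE !normCK; ring.
(* Coefficient of X_{-u}: the two terms are conj(a_{0,m}) a_{u,m} S / Delta with opposite signs. *)
- rewrite (gsum (fun k => A k p)) AppS.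
  under eq_bigr do rewrite mulrC.
  rewrite (sumAc (fun k => A k p)) Amp alpha0E /alphau; ring.
- by move=> j jm jp; rewrite (gMA _ (ltnW jm)) (ltn_eqF jm) (negPf jp) !mulr0 addr0.
split.
  (* Only Y_m pairs with X_0, since p < m, so the error equals alpha'_0. *)
  rewrite err gMA // eqxx (gtn_eqF pm) mulr1 mulr0 addr0 conjCK.
  exact: (mulrC (Delta^-1) S).
apply: filterS eqX => t ->.
pose E (k : nat) := finite_innovation P X m (k%:Z - m%:Z) t.
rewrite (gsum E) (sumAp E).
under eq_bigr do rewrite mulrC.
rewrite (sumAc E) /E subrr [finite_innovation _ _ _ _ _ * _]mulrC mulrA; congr (_ + _ * _).
rewrite !big_nat; apply: eq_bigr => k /andP[_ ku].
by rewrite (_ : (m - k)%N%:Z - m%:Z = - k%:Z) //; lia.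
Qed.
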